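(* (Infinite case) Let $\gamma=(\gamma_0,\gamma_1,\gamma_2,\ldots)$ be an infinite sequence of positive real numbers. Then $\gamma$ is a multiplier sequence of the third kind, i.e. $T_\gamma(SI^{\geq})\subseteq RR$, if and only if $\gamma$ is log-concave, i.e. $\gamma_j^2\geq\gamma_{j-1}\gamma_{j+1}$ for all $j\geq 1$ (equivalently, $T_\gamma(x^n(1+x)^2)\in RR$ for all integers $n\geq 0$). Moreover, any such $\gamma$ satisfies $T_\gamma(SI^{\geq})\subseteq SI^{\geq}$. (Finite case) Let $k\geq 1$ be an integer and let $\gamma=(\gamma_0,\ldots,\gamma_k)$ be a finite sequence of positive real numbers. Then $\gamma$ is a finite multiplier sequence of the third kind, i.e. $T_\gamma(SI^{\geq}_k)\subseteq RR$, if and only if $\gamma$ is log-concave, i.e. $\gamma_j^2\geq\gamma_{j-1}\gamma_{j+1}$ for all $1\leq j\leq k-1$ (equivalently, $T_\gamma(x^n(1+x)^2)\in RR$ for all integers $0\leq n\leq k-2$). Moreover, any such $\gamma$ satisfies $T_\gamma(SI^{\geq}_k)\subseteq SI^{\geq}_k$.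
   Context: For a sequence $\gamma=(\gamma_j)_{j\geq 0}$ of real numbers, the diagonal operator $T_\gamma:\mathbb{R}[x]\to\mathbb{R}[x]$ is the linear map with $T_\gamma(x^j)=\gamma_j x^j$ for all $j$. For a finite sequence $\gamma=(\gamma_0,\ldots,\gamma_k)$, $T_\gamma$ is defined in the same way on $\mathbb{R}_k[x]$, the space of real polynomials of degree at most $k$. $RR\subset\mathbb{R}[x]$ denotes the set of real-rooted polynomials, i.e. those all of whose complex roots are real. A real polynomial $p(x)=\sum_i a_i x^i$ is called sign-independently real-rooted if $p$ is real-rooted and every polynomial obtained from $p$ by arbitrary sign flips of its coefficients, i.e. every $\sum_i \varepsilon_i a_i x^i$ with $\varepsilon_i\in\{1,-1\}$, is real-rooted as well. $SI$ is the set of all sign-independently real-rooted polynomials, $SI^{\geq}$ is the subset of $SI$ consisting of polynomials with all coefficients nonnegative, and $SI^{\geq}_k=SI^{\geq}\cap\mathbb{R}_k[x]$. *)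

(* Defs.v *)
From HB Require Import structures.
From mathcomp Require Import all_boot all_order all_algebra.
From mathcomp Require Import classical_sets reals complex.

Set Implicit Arguments.
Unset Strict Implicit.
Unset Printing Implicit Defensive.

Import Order.TTheory GRing.Theory Num.Theory.

Local Open Scope ring_scope.
Local Open Scope classical_set_scope.

(* For a finite sequence (gamma_0, ..., gamma_k) we use [diag_op (nth 0 gamma)]
   and only ever apply it to polynomials of degree at most k, where the default
   value 0 is never read. *)
Definition diag_op (R : nzRingType) (gamma : nat -> R) (p : {poly R}) : {poly R} :=
  \poly_(i < size p) (gamma i * p`_i).

Lemma coef_diag_op (R : nzRingType) (gamma : nat -> R) (p : {poly R}) (i : nat) :
  (diag_op gamma p)`_i = gamma i * p`_i.
Proof.
by rewrite coef_poly; case: ltnP => // le_p_i; rewrite nth_default ?mulr0.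
Qed.

(* [diag_op gamma] is the linear map sending 'X^j to gamma_j 'X^j. *)
Lemma diag_op_linear (R : comNzRingType) (gamma : nat -> R) :
  linear (diag_op gamma).
Proof.
move=> a p q; apply/polyP => i.
by rewrite !(coef_diag_op, coefD, coefZ) mulrDr mulrCA.
Qed.

HB.instance Definition _ (R : comNzRingType) (gamma : nat -> R) :=
  GRing.isLinear.Build R {poly R} {poly R} _ (diag_op gamma)
    (diag_op_linear gamma).

Lemma diag_opXn (R : nzRingType) (gamma : nat -> R) (j : nat) :
  diag_op gamma 'X^j = gamma j *: 'X^j.
Proof.
apply/polyP => i; rewrite coef_diag_op coefZ coefXn.
by case: eqP => [->|]; rewrite ?mulr0.
Qed.

(* The zero polynomial, which vanishes at every complex number, is not in [RR],
   hence not in [SI].  This convention is harmless for positive sequences gamma,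
   for which [diag_op gamma p] is zero exactly when p is. *)
Definition RR (R : realType) : set {poly R} :=
  [set p | forall z : complex R,
     root (map_poly (real_complex R) p) z -> complex.Im z = 0].

Definition SI (R : realType) : set {poly R} :=
  [set p | RR p /\ forall eps : nat -> bool,
     RR (\poly_(i < size p) ((-1) ^+ eps i * p`_i))].

Definition SInn (R : realType) : set {poly R} :=
  [set p | SI p /\ forall i, 0 <= p`_i].

Definition SInn_deg (R : realType) (k : nat) : set {poly R} :=
  [set p | SInn p /\ (size p <= k.+1)%N].

Arguments RR : clear implicits.
Arguments SI : clear implicits.
Arguments SInn : clear implicits.
Arguments SInn_deg : clear implicits.

(* Main.v *)
(* A polynomial p of nonnegative coefficients with p(0) > 0 is sign-independently
   real-rooted iff, for every k <= deg p, the k-th monomial dominates somewhere: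
   p_k x^k >= sum_(j != k) p_j x^j, i.e. p(x) <= 2 p_k x^k, for some x > 0.
   If all these inequalities are strict, any sign flip of p has one root
   of absolute value between the k-th and the (k+1)-st such points, for every k;
   the weak case follows by perturbing p_i to t^(i^2) p_i with t < 1 tending to 1.
   Log-concavity of gamma gives tau > 0 such that gamma_j tau^j is maximal at j = k,
   so domination of the k-th monomial of p at x gives that of T_gamma p at tau x. *)

Require Import Defs.
From mathcomp Require Import all_boot all_order all_algebra.
From mathcomp Require Import classical_sets reals.
From mathcomp Require Import complex polyrcf ring lra zify.

Set Implicit Arguments.
Unset Strict Implicit.
Unset Printing Implicit Defensive.

Import Order.TTheory GRing.Theory Num.Theory.

Local Open Scope ring_scope.
Local Open Scope classical_set_scope.

(** * Algebra of diagonal operators *)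

Lemma diag_op_comp (R : nzRingType) (f g : nat -> R) (p : {poly R}) :
  diag_op f (diag_op g p) = diag_op (fun i => f i * g i) p.
Proof. by apply/polyP => i; rewrite !coef_diag_op mulrA. Qed.

Lemma diag_op_XnM (R : comNzRingType) (f : nat -> R) (m : nat) (p : {poly R}) :
  diag_op f ('X^m * p) = 'X^m * diag_op (fun i => f (i + m)%N) p.
Proof.
apply/polyP => i; rewrite coef_diag_op !coefXnM.
by case: ltnP => [_|mi]; rewrite ?mulr0// coef_diag_op subnK.
Qed.

Lemma diag_op_id (R : nzRingType) (f : nat -> R) (p : {poly R}) :
  (forall i, (i < size p)%N -> f i = 1) -> diag_op f p = p.
Proof.
move=> f1; apply/polyP => i; rewrite coef_diag_op.
by case: (ltnP i (size p)) => [/f1->|ip]; rewrite ?mul1r// nth_default ?mulr0.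
Qed.

Lemma size_diag_op (R : idomainType) (f : nat -> R) (p : {poly R}) :
  (forall i, (i < size p)%N -> f i != 0) -> size (diag_op f p) = size p.
Proof.
have [-> _|p0 f0] := eqVneq p 0; first by rewrite linear0.
rewrite size_poly_eq// mulf_neq0//; last by rewrite -lead_coefE lead_coef_eq0.
by rewrite f0// prednK// size_poly_gt0.
Qed.

(** * Real-rooted polynomials and the signs of their coefficients *)

Lemma RR_XnM (R : realType) (m : nat) (p : {poly R}) :
  RR R p -> RR R ('X^m * p).
Proof.
move=> pR z; rewrite rmorphM/= map_polyXn rootM => /orP[|]; last exact: pR.
by rewrite rootE hornerXn expf_eq0 => /andP[_ /eqP->].
Qed.

Lemma RR_mulr (R : realType) (p q : {poly R}) : RR R (p * q) -> RR R q.
Proof. by move=> pqR z qz; apply: pqR; rewrite rmorphM rootM qz orbT. Qed.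

Lemma SInnE (R : realType) (p : {poly R}) :
  SInn R p <-> (forall eps : nat -> bool,
    RR R (diag_op (fun i => (-1) ^+ eps i) p)) /\ forall i, 0 <= p`_i.
Proof.
split=> [[[_ ?] ?]//|[pR p_ge0]]; split=> //; split=> //.
by have := pR (fun=> false); rewrite diag_op_id.
Qed.

Lemma RR_split (R : realType) (p : {poly R}) : RR R p ->
  exists rs : seq R, p = lead_coef p *: \prod_(r <- rs) ('X - r%:P).
Proof.
move=> pR; have [zs zsE] := closed_field_poly_normal (map_poly (real_complex R) p).
(* The zero polynomial vanishes at ['i], so it is not in [RR]. *)
have p0 : p != 0.
  apply/eqP => p0; have := pR 'i%C; rewrite p0 rmorph0 root0 => /(_ isT)/eqP.
  by rewrite oner_eq0.
have zsR : all (fun z => complex.Im z == 0) zs.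
  apply/allP => z zzs; apply/eqP/pR; rewrite zsE rootZ ?root_prod_XsubC//.
  by rewrite lead_coef_map fmorph_eq0 lead_coef_eq0.
exists (map (@complex.Re R) zs); apply: (map_poly_inj (real_complex R)).
rewrite [LHS]zsE lead_coef_map map_polyZ/= map_prod_XsubC big_map.
congr (_ *: _); apply: eq_big_seq => z /(allP zsR)/eqP z0; congr ('X - _%:P).
by case: z z0 => /= a b ->.
Qed.

Lemma coef_prod_XsubC_gt0 (R : numDomainType) (rs : seq R) (i : nat) :
  all (fun r => r < 0) rs -> (i <= size rs)%N ->
  0 < (\prod_(r <- rs) ('X - r%:P))`_i.
Proof.
elim: rs i => [|r rs IH] i; first by case: i => //; rewrite big_nil coef1.
rewrite /= => /andP[r0 rs0] ile; rewrite big_cons mulrBl coefB coefXM coefCM.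
rewrite -mulNr; have [i0|i0] := posnP i.
  by rewrite add0r i0 mulr_gt0 ?oppr_gt0// IH.
have h1 : 0 < (\prod_(j <- rs) ('X - j%:P))`_i.-1 by rewrite IH// -ltnS prednK.
move: ile; rewrite leq_eqVlt => /orP[/eqP ie|il].
  by rewrite [_`_i]nth_default ?mulr0 ?addr0// size_prod_XsubC ie.
by rewrite addr_gt0// mulr_gt0 ?oppr_gt0// IH.
Qed.

(** All roots are then negative, so [p] is its leading coefficient times a product of factors
    ['X + s] with [s > 0], and such a product has positive coefficients up to its degree. *)
Lemma RR_same_sign (R : realType) (p : {poly R}) (i : nat) :
  RR R p -> (forall x, 0 <= x -> ~~ root p x) -> (i < size p)%N ->
  0 < lead_coef p * p`_i.
Proof.
move=> pR pN0 ip; have p0 : p != 0 by rewrite -size_poly_gt0 (leq_ltn_trans _ ip).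
have [rs pE] := RR_split pR.
have rs0 : all (fun r => r < 0) rs.
  apply/allP => r rrs; rewrite ltNge; apply/negP => /pN0/negP; apply.
  by rewrite pE rootZ ?lead_coef_eq0// root_prod_XsubC.
have := ip; rewrite {1}pE size_scale ?lead_coef_eq0// size_prod_XsubC ltnS => irs.
rewrite {2}pE coefZ mulrA -expr2 mulr_gt0 ?exprn_even_gt0//= ?lead_coef_eq0//.
exact: coef_prod_XsubC_gt0.
Qed.

(** * Domination of one monomial at a positive point, and sign flips *)

Lemma horner_gt0 (R : numDomainType) (p : {poly R}) (x : R) :
  (forall i, 0 <= p`_i) -> 0 < p`_0 -> 0 <= x -> 0 < p.[x].
Proof.
move=> p_ge0 p0 x0; rewrite horner_coef.
case: (size p) (leqSpred (size p)) (@nth_default _ 0 p 0) => [_ /(_ isT) pz|n _ _].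
  by rewrite pz ltxx in p0.
rewrite big_ord_recl mulr1 ltr_wpDr// sumr_ge0// => i _.
by rewrite mulr_ge0// exprn_ge0.
Qed.

(** Such a [p] is positive on the nonnegative axis, so all its roots are negative and no coefficient
    up to the degree can vanish. *)
Lemma SInn_coef_gt0 (R : realType) (p : {poly R}) (k : nat) :
  SInn R p -> 0 < p`_0 -> (k < size p)%N -> 0 < p`_k.
Proof.
move=> [[pR _] p_ge0] p0 kp; have pN0 x : 0 <= x -> ~~ root p x.
  by move=> x0; rewrite rootE gt_eqF// horner_gt0.
have := RR_same_sign pR pN0 kp.
by rewrite pmulr_rgt0// lt_def p_ge0 lead_coef_eq0 -size_poly_gt0 (leq_ltn_trans _ kp).
Qed.

(* Flipping the sign of the k-th coefficient alone gives p - 2 p_k X^k, whose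
   coefficients have both signs, so this real-rooted polynomial has a positive
   root. *)
Lemma SInn_lopsided (R : realType) (p : {poly R}) (k : nat) :
  SInn R p -> 0 < p`_0 -> (k < size p)%N ->
  exists2 x, 0 < x & p.[x] <= 2 * p`_k * x ^+ k.
Proof.
move=> pS p0 kp; have p_gt0 i := @SInn_coef_gt0 R p i pS p0.
(* A constant is treated apart: it has no second coefficient whose sign could be compared with the
   flipped one. *)
have [p1|p1] := leqP (size p) 1.
  exists 1 => //; have pC := size1_polyC p1; rewrite pC size_polyC in kp *.
  have -> : k = 0%N by case: (_ != _) kp; case: (k).
  by rewrite hornerC coefC/= mulr1; lra.
set q := diag_op (fun i => (-1) ^+ (i == k)) p.
have qR : RR R q by case/SInnE: pS => /(_ (fun i => i == k)).
have sq : size q = size p by rewrite size_diag_op// => i _; rewrite signr_eq0.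
have qE x : q.[x] = p.[x] - 2 * p`_k * x ^+ k.
  rewrite !horner_coef sq (bigD1 (Ordinal kp))//= [in RHS](bigD1 (Ordinal kp))//=.
  rewrite coef_diag_op eqxx (eq_bigr (fun i : 'I_(size p) => p`_i * x ^+ i)).
    by rewrite expr1; ring.
  move=> i; rewrite -val_eqE/= => /negPf ik.
  by rewrite coef_diag_op ik expr0 mul1r.
case: (boolp.pselect (exists2 x, 0 < x & root q x)) => [[x x0]|qN].
  by rewrite rootE qE subr_eq0 => /eqP px; exists x; rewrite ?px.
have qN0 x : 0 <= x -> ~~ root q x.
  rewrite le_eqVlt => /orP[/eqP <-|x0]; last by apply/negP => qx; apply: qN; exists x.
  by rewrite rootE horner_coef0 coef_diag_op mulf_neq0 ?signr_eq0 ?gt_eqF.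
(* Any index other than [k] serves: the coefficient of [q] there stays positive while the one at [k]
   turns negative, against [RR_same_sign]. *)
pose j := if k is 0 then 1%N else 0%N.
have jp : (j < size q)%N by rewrite sq /j; case: (k) => [|_]; rewrite ?p1 ?(ltnW p1).
have jk : (j == k) = false by rewrite /j; case: (k).
have kq : (k < size q)%N by rewrite sq.
have := RR_same_sign qR qN0 kq; have := RR_same_sign qR qN0 jp.
rewrite !coef_diag_op eqxx jk expr0 mul1r expr1 mulN1r mulrN oppr_gt0 sq in jp *.
rewrite pmulr_lgt0 ?p_gt0// => ? ?.
have : 0 < p`_k by apply: p_gt0.
by nra.
Qed.

(* The terms of equal index on the right either cancel or double, and those of
   index k double. *)
Lemma horner_flip_ge (R : realDomainType) (p : {poly R}) (eps : nat -> bool)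
    (k : nat) (x : R) :
  (forall i, 0 <= p`_i) -> 0 <= x ->
  2 * p`_k * x ^+ k <=
    p.[x] + (-1) ^+ eps k * (diag_op (fun i => (-1) ^+ eps i) p).[x].
Proof.
move=> p_ge0 x0.
have t_ge0 i : 0 <= p`_i * x ^+ i by rewrite mulr_ge0 ?exprn_ge0.
rewrite !horner_coef size_diag_op; last by move=> i _; rewrite signr_eq0.
rewrite mulr_sumr -big_split/=.
have e_ge0 i : 0 <= p`_i * x ^+ i + (-1) ^+ eps k *
    ((diag_op (fun i => (-1) ^+ eps i) p)`_i * x ^+ i).
  rewrite coef_diag_op; have := t_ge0 i.
  by case: (eps i); case: (eps k); rewrite ?expr0 ?expr1; lra.
have [pk|kp] := leqP (size p) k.
  by rewrite [p`_k]nth_default// mulr0 mul0r sumr_ge0.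
rewrite (bigD1 (Ordinal kp))//= ler_wpDr ?sumr_ge0//.
by rewrite coef_diag_op; case: (eps k); rewrite ?expr0 ?expr1; lra.
Qed.

(** Passing to a negative point amounts to flipping the coefficients of odd index, so estimates at
    positive points serve both half-axes. *)
Lemma diag_op_comp_poly_scaleX (R : comNzRingType) (f : nat -> R) (p : {poly R})
    (c : bool) (x : R) :
  (diag_op (fun i => (-1) ^+ (c && odd i) * f i) p).[x] =
  (diag_op f p).[(-1) ^+ c * x].
Proof.
rewrite !(@horner_coef_wide _ (size p)); last 2 first.
- exact: size_poly.
- exact: size_poly.
apply: eq_bigr => i _; rewrite !coef_diag_op.
case: c => /=; last by rewrite expr0 !mul1r.
by rewrite exprMn expr1 -(signr_odd _ i); ring.
Qed.

(** * Strict domination by every monomial yields a full set of real roots for each flip *)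

Section StrictlyLopsided.
Variables (R : rcfType) (p : {poly R}) (eps : nat -> bool).
Hypothesis p_gt0 : forall i, (i < size p)%N -> 0 < p`_i.
Hypothesis p_lop : forall k, (k < size p)%N ->
  exists2 x, 0 < x & p.[x] < 2 * p`_k * x ^+ k.

Let q := diag_op (fun i => (-1) ^+ eps i) p.

Let p_ge0 i : 0 <= p`_i.
Proof.
by case: (ltnP i (size p)) => [/p_gt0/ltW//|ip]; rewrite nth_default.
Qed.

Let term_le_horner j x : (j < size p)%N -> 0 < x -> p`_j * x ^+ j <= p.[x].
Proof.
move=> jp x0; rewrite horner_coef (bigD1 (Ordinal jp))//= ler_wpDr// sumr_ge0//.
by move=> i _; rewrite mulr_ge0// exprn_ge0 ?ltW.
Qed.

Let two_terms_le_horner j x : (j.+1 < size p)%N -> 0 < x ->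
  p`_j * x ^+ j + p`_j.+1 * x ^+ j.+1 <= p.[x].
Proof.
move=> jp x0; rewrite horner_coef (bigD1 (Ordinal (ltnW jp)))//=.
rewrite (bigD1 (Ordinal jp))/=; last by rewrite -val_eqE/= gtn_eqF.
rewrite lerD2l ler_wpDr// sumr_ge0//.
by move=> i _; rewrite mulr_ge0// exprn_ge0 ?ltW.
Qed.

(** The [j]-th term exceeds the next one at [x] and is exceeded by it at [y], while the ratio of the
    two terms, [p_(j+1) x / p_j], increases with the point. *)
Let lopsided_lt j x y : (j.+1 < size p)%N -> 0 < x -> 0 < y ->
  p.[x] < 2 * p`_j * x ^+ j -> p.[y] < 2 * p`_j.+1 * y ^+ j.+1 -> x < y.
Proof.
move=> jp x0 y0 px py.
have := two_terms_le_horner jp x0; have := two_terms_le_horner jp y0.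
move: px py; rewrite !exprS => px py hy hx.
have xj : 0 < x ^+ j by rewrite exprn_gt0.
have yj : 0 < y ^+ j by rewrite exprn_gt0.
have h1 : 0 < x ^+ j * (p`_j - p`_j.+1 * x) by nra.
have h2 : 0 < y ^+ j * (p`_j.+1 * y - p`_j) by nra.
rewrite !pmulr_rgt0// in h1 h2.
have : 0 < p`_j.+1 * (y - x) by lra.
by rewrite pmulr_rgt0 ?p_gt0// subr_gt0.
Qed.

(** The exponent records the sign of the [k]-th term of [q] at [(-1) ^+ c * x]; the other terms
    together are too small to change it. *)
Let q_sign k c x : (k < size p)%N -> 0 < x -> p.[x] < 2 * p`_k * x ^+ k ->
  0 < (-1) ^+ (eps k (+) (c && odd k)) * q.[(-1) ^+ c * x].
Proof.
move=> kp x0 px.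
have := horner_flip_ge (fun i => (c && odd i) (+) eps i) k p_ge0 (ltW x0).
rewrite /q -diag_op_comp_poly_scaleX addbC.
under [X in _ <= _ + _ * X.[_] -> _]eq_poly do rewrite signr_addb.
rewrite -/(diag_op _ _); lra.
Qed.

Let root_between k x y : (k.+1 < size p)%N -> 0 < x -> 0 < y ->
  p.[x] < 2 * p`_k * x ^+ k -> p.[y] < 2 * p`_k.+1 * y ^+ k.+1 ->
  exists2 r, root q r & x < `|r| < y.
Proof.
move=> kp x0 y0 px py; have xy := lopsided_lt kp x0 y0 px py.
(* [c] picks the half-axis: terms [k] and [k.+1] of [q] have opposite signs at positive points if
   the flips differ, at negative points if they agree. Either way [q] changes sign there. *)
pose c := eps k == eps k.+1.
have qx := q_sign c (ltnW kp) x0 px; have qy := q_sign c kp y0 py.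
pose qc := q \Po ((-1) ^+ c *: 'X).
have qcE z : qc.[z] = q.[(-1) ^+ c * z] by rewrite horner_comp !hornerE.
have [|z] := @poly_ivtoo _ qc x y (ltW xy).
  move: qx qy; rewrite !qcE /c/=.
  by case: (eps k); case: (eps k.+1); case: (odd k);
    rewrite /= ?expr0 ?expr1; nra.
rewrite in_itv/= => /andP[xz zy] qz; exists ((-1) ^+ c * z).
  by rewrite rootE -qcE.
by rewrite normrMsign gtr0_norm ?xz// (lt_trans x0).
Qed.

Lemma strictly_lopsided_split : p != 0 -> exists rs : seq R,
  q = lead_coef q *: \prod_(r <- rs) ('X - r%:P).
Proof.
rewrite -size_poly_gt0 => sp; have sq : size q = size p.
  by rewrite size_diag_op// => i _; rewrite signr_eq0.
(* The induction keeps a point [x] that dominates for index [n] and exceeds all roots found in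
   absolute value. The next root lies beyond [x], hence is new. *)
have main n : (n < size p)%N -> exists rs : seq R, [/\ size rs = n, uniq rs,
    all (root q) rs & exists x, [/\ 0 < x, p.[x] < 2 * p`_n * x ^+ n &
      all (fun r => `|r| < x) rs]].
  elim: n => [|n IH] np.
    by exists [::]; split => //; have [x x0 px] := p_lop np; exists x.
  have [rs [srs urs qrs [x [x0 px rs_lt]]]] := IH (ltnW np).
  have [y y0 py] := p_lop np.
  have [r qr /andP[xr ry]] := root_between np x0 y0 px py.
  exists (r :: rs); split => /=; rewrite ?srs ?qr//.
    rewrite urs andbT; apply/negP => /(allP rs_lt).
    by rewrite ltNge ltW.
  exists y; split => //; rewrite /= ry; apply/allP => s /(allP rs_lt) sx.
  exact: lt_trans sx (lt_trans xr ry).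
have [|rs [srs urs qrs _]] := main (size p).-1; first by rewrite prednK.
exists rs; apply: all_roots_prod_XsubC => //; first by rewrite sq srs prednK.
by rewrite uniq_rootsE.
Qed.
End StrictlyLopsided.

(* By lopsidedness of p, it is enough that gamma_j tau^j be maximal at j = k. *)
Lemma horner_diag_op_le (R : realDomainType) (p : {poly R}) (gamma : nat -> R)
    (k : nat) (tau c x : R) :
  (forall i, 0 <= p`_i) -> 0 <= x -> 0 <= c * (gamma k * tau ^+ k) ->
  (forall j, (j < size p)%N -> j != k ->
    gamma j * tau ^+ j <= c * (gamma k * tau ^+ k)) ->
  (k < size p)%N -> p.[x] <= 2 * p`_k * x ^+ k ->
  (diag_op gamma p).[tau * x] <= (1 + c) * (diag_op gamma p)`_k * (tau * x) ^+ k.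
Proof.
move=> p_ge0 x0 ck le_k kp.
rewrite (@horner_coef_wide _ (size p) (diag_op gamma p)) ?size_poly//.
rewrite horner_coef (bigD1 (Ordinal kp))//= [in X in _ -> X](bigD1 (Ordinal kp))//=.
set S := \sum_(i < _ | _) _ => px.
have S_le : S <= p`_k * x ^+ k by lra.
have {S_le} := ler_wpM2l ck S_le; rewrite /S mulr_sumr => S_le.
rewrite [_ * _`_k]mulrDl [X in _ <= X]mulrDl mul1r lerD2l.
rewrite coef_diag_op exprMn; apply: le_trans (le_trans S_le _); last first.
  by rewrite le_eqVlt; apply/orP; left; apply/eqP; ring.
apply: ler_sum => i ik; rewrite coef_diag_op exprMn.
have -> : gamma i * p`_i * (tau ^+ i * x ^+ i) =
          gamma i * tau ^+ i * (p`_i * x ^+ i) by ring.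
by rewrite ler_wpM2r ?le_k// mulr_ge0// exprn_ge0.
Qed.

(** * Log-concave sequences *)

Section LogConcave.
Variables (R : realFieldType) (gamma : nat -> R) (N : nat).
Hypothesis gamma_gt0 : forall i, (i < N)%N -> 0 < gamma i.
Hypothesis gamma_lc : forall j, (1 <= j)%N -> (j.+1 < N)%N ->
  gamma j.-1 * gamma j.+1 <= gamma j ^+ 2.

(** Consecutive ratios [gamma j.+1 / gamma j] do not increase; the inequality is this fact with
    denominators cleared. *)
Lemma log_concave_ratio i j : (i <= j)%N -> (j.+1 < N)%N ->
  gamma i * gamma j.+1 <= gamma i.+1 * gamma j.
Proof.
elim: j => [|j IH]; first by rewrite leqn0 => /eqP -> _; rewrite mulrC.
rewrite leq_eqVlt => /orP[/eqP-> _|]; first by rewrite mulrC.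
move=> ij jN; have := IH ij (ltnW jN); have := @gamma_lc j.+1 isT jN => /= h1 h2.
have gj := gamma_gt0 (ltnW (ltnW jN)); have gj1 := gamma_gt0 (ltnW jN).
have gi := gamma_gt0 (leq_trans ij (ltnW (ltnW jN))).
rewrite -(ler_pM2l gj); have h3 := ler_wpM2l (ltW gi) h1.
by have := ler_wpM2l (ltW gj1) h2; nra.
Qed.

Lemma log_concave_argmax k : (k < N)%N -> exists2 tau, 0 < tau &
  forall j, (j < N)%N -> gamma j * tau ^+ j <= gamma k * tau ^+ k.
Proof.
move=> kN; have [N1|N1] := leqP N 1.
  exists 1 => // j jN; rewrite !expr1n.
  by have -> : j = k by move: (leq_trans jN N1) (leq_trans kN N1); case: j jN k kN => [|?] _ [|?].
have k1N : (k.-1.+1 < N)%N by case: k kN.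
have g0 := gamma_gt0 (ltnW k1N); have g1 := gamma_gt0 k1N.
(* This [tau] equalizes the terms of index [k.-1] and [k.-1.+1], one of which is [k]; the terms rise
   before them and fall after. For [k = 0] the two indices are 0 and 1, hence the separate case
   [N <= 1]. *)
pose tau := gamma k.-1 / gamma k.-1.+1.
have tau0 : 0 < tau by rewrite divr_gt0.
have down j : (k.-1 <= j)%N -> (j.+1 < N)%N ->
    gamma j.+1 * tau ^+ j.+1 <= gamma j * tau ^+ j.
  move=> kj jN; rewrite exprS mulrA ler_pM2r ?exprn_gt0// /tau mulrA.
  by rewrite ler_pdivrMr// mulrC [X in _ <= X]mulrC log_concave_ratio.
have up j : (j <= k.-1)%N -> gamma j * tau ^+ j <= gamma j.+1 * tau ^+ j.+1.
  move=> kj; rewrite exprS mulrA ler_pM2r ?exprn_gt0// /tau mulrA.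
  by rewrite ler_pdivlMr// log_concave_ratio.
exists tau => // j jN; have [kj|jk] := leqP k j.
  rewrite -(subnKC kj) in jN *; elim: (j - k)%N jN => [|i IH]; first by rewrite addn0.
  rewrite addnS => iN; apply: le_trans (IH (ltnW iN)).
  by rewrite down// (leq_trans (leq_pred k)) ?leq_addr.
rewrite -(subKn (ltnW jk)); elim: (k - j)%N (leq_subr j k) => [|d IH] dk.
  by rewrite subn0.
apply: le_trans (IH (ltnW dk)); rewrite -(subnSK dk) up//.
by rewrite -subn1 leq_sub2l.
Qed.
End LogConcave.

(** * From strict to weak domination, by a quantitative limit *)

Lemma bernoulli_expr (R : realDomainType) (n : nat) (t : R) :
  0 <= t <= 1 -> 1 - t ^+ n <= n%:R * (1 - t).
Proof.
move=> /andP[t0 t1]; elim: n => [|n IH]; first by rewrite expr0 mul0r subrr.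
have tn : t ^+ n <= 1 by rewrite exprn_ile1.
by rewrite exprS -natr1; nra.
Qed.

(** This is the limit [t -> 1], with one explicit [t] and Bernoulli's inequality in place of
    continuity. *)
Lemma le0_of_small_power (R : realFieldType) (N : nat) (c m : R) :
  (forall t, 0 < t < 1 -> c * t ^+ N <= (1 - t) * m) -> c <= 0.
Proof.
move=> H; rewrite leNgt; apply/negP => c0.
have hm : 0 <= m.
  have := H 2^-1; have t0 : 0 < 2^-1 :> R by rewrite invr_gt0.
  have t1 : 2^-1 < 1 :> R by rewrite invf_lt1// ltr1n.
  rewrite t0 t1 => /(_ isT) h.
  have h2 : 0 < c * 2^-1 ^+ N by rewrite mulr_gt0// exprn_gt0.
  have : 0 < (1 - 2^-1) * m by apply: lt_le_trans h.
  by rewrite pmulr_rgt0 ?subr_gt0// => /ltW.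
have d0 : 0 < m + c * N%:R + 2 * c.
  by rewrite ltr_wpDl ?mulr_gt0// addr_ge0// mulr_ge0 ?ler0n// ltW.
(* At [t = 1 - s], Bernoulli's inequality and the hypothesis give [c <= s * (m + c * N%:R)], which
   is [c - 2 * s * c] by the choice of [s]: a contradiction. The summand [2 * c] also ensures
   [s < 1]. *)
pose s := c / (m + c * N%:R + 2 * c).
have s0 : 0 < s by rewrite divr_gt0.
have sE : s * (m + c * N%:R + 2 * c) = c by rewrite divfK ?gt_eqF.
have cN : 0 <= c * N%:R by rewrite mulr_ge0 ?ler0n// ltW.
have s1 : s < 1 by rewrite /s ltr_pdivrMr// mul1r; lra.
have st : 0 <= 1 - s <= 1 by apply/andP; split; lra.
have := H (1 - s); have -> : 0 < 1 - s < 1 by apply/andP; split; lra.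
move=> /(_ isT) h; have b := ler_wpM2l (ltW c0) (bernoulli_expr N st).
have : 0 < s * c by rewrite mulr_gt0.
by nra.
Qed.

(** Each factor satisfies [|z - r| >= |Im z|] since [r] is real. This lower bound off the real axis
    is what survives the limit, replacing continuity of roots. *)
Lemma split_norm_ge (R : rcfType) (p : {poly R}) (rs : seq R) (z : complex R) :
  p = lead_coef p *: \prod_(r <- rs) ('X - r%:P) ->
  (`|lead_coef p| * `|complex.Im z| ^+ (size p).-1)%:C%C
    <= `|(map_poly (real_complex R) p).[z]|.
Proof.
have [->|p0] := eqVneq p 0; first by rewrite lead_coef0 normr0 mul0r normr_ge0.
move=> pE; have -> : (size p).-1 = size rs.
  by rewrite {1}pE size_scale ?lead_coef_eq0// size_prod_XsubC.
rewrite [in X in _ <= X]pE map_polyZ/= map_prod_XsubC hornerZ horner_prod normrM.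
rewrite rmorphM/= normc_def/= expr0n addr0 sqrtr_sqr.
apply: ler_wpM2l; first by rewrite ler0c normr_ge0.
elim: rs {pE} => [|r rs IH]; first by rewrite !big_nil normr1.
rewrite big_cons normrM /= exprS rmorphM; apply: ler_pM => //.
  by rewrite ler0c.
by rewrite ler0c exprn_ge0.
rewrite hornerXsubC normc_def -[`|complex.Im z|]sqrtr_sqr.
rewrite lecR ler_wsqrtr//; case: z {IH} => a b /=.
by rewrite oppr0 addr0 lerDr sqr_ge0.
Qed.

(** Damping the coefficients by [t ^+ (i ^ 2)] makes domination strict, so the damped flip [qt]
    splits. At a root [z] of [q], [|qt(z)| = |qt(z) - q(z)|] is at most a multiple of [1 - t],
    whereas [split_norm_ge] bounds it below by a multiple of [|Im z| ^+ n]. *)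
Lemma lopsided_flip_RR (R : realType) (p : {poly R}) (eps : nat -> bool) :
  p != 0 -> (forall i, (i < size p)%N -> 0 < p`_i) ->
  (forall k, (k < size p)%N -> exists2 x, 0 < x & p.[x] <= 2 * p`_k * x ^+ k) ->
  RR R (diag_op (fun i => (-1) ^+ eps i) p).
Proof.
move=> p0 p_gt0 p_lop z; set q := diag_op _ p => qz.
have sp : (0 < size p)%N by rewrite size_poly_gt0.
have sn0 i : (i < size p)%N -> (-1) ^+ eps i != 0 :> R by rewrite signr_eq0.
have p_ge0 i : 0 <= p`_i.
  by case: (ltnP i (size p)) => [/p_gt0/ltW//|ip]; rewrite nth_default.
pose n := (size p).-1; have np : (n < size p)%N by rewrite prednK.
apply/eqP; rewrite -normr_le0.
(* [M] bounds [|qt(z) - q(z)| / (1 - t)], because [1 - t ^+ (i ^ 2)] is at most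
   [i ^ 2 * (1 - t)]. *)
pose M : complex R := \sum_(i < size p) `|(q`_i)%:C%C * z ^+ i| * (i ^ 2)%:R.
have M0 : 0 <= M by rewrite sumr_ge0// => i _; rewrite mulr_ge0 ?ler0n.
have ME : M = (complex.Re M)%:C%C by case: (M) (ger0_Im M0) => /= a b ->.
suff : p`_n * `|complex.Im z| ^+ n <= 0.
  rewrite pmulr_rle0 ?p_gt0// => h.
  have : `|complex.Im z| ^+ n == 0 by rewrite eq_le h exprn_ge0.
  by rewrite expf_eq0 => /andP[_ /eqP->].
apply: (@le0_of_small_power _ (n ^ 2) _ (complex.Re M)) => t /andP[t0 t1].
pose pt := diag_op (fun i => t ^+ (i ^ 2)) p.
have tn0 i : (i < size p)%N -> t ^+ (i ^ 2) != 0 by rewrite expf_neq0 ?gt_eqF.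
have spt : size pt = size p by rewrite size_diag_op.
have ptE i : pt`_i = t ^+ (i ^ 2) * p`_i by rewrite coef_diag_op.
have pt_gt0 i : (i < size pt)%N -> 0 < pt`_i.
  by rewrite spt ptE => ip; rewrite mulr_gt0 ?p_gt0// exprn_gt0.
have pt_lop k : (k < size pt)%N -> exists2 x, 0 < x & pt.[x] < 2 * pt`_k * x ^+ k.
  move=> kp; have [|x x0 px] := p_lop k; first by rewrite -spt.
  (* Then [t ^+ (j ^ 2) * tau ^+ j] is [t] to the power [(j - k)^2 - k^2]. For [j != k] it falls
     below its value at [k] by a factor [t] at least, so the constant 2 improves to [1 + t]. *)
  pose tau := t ^- (2 * k); have tau0 : 0 < tau by rewrite invr_gt0 exprn_gt0.
  exists (tau * x); first by rewrite mulr_gt0.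
  apply: le_lt_trans
    (@horner_diag_op_le R p (fun i => t ^+ (i ^ 2)) k tau t x _ _ _ _ _ px) _ => //.
  - exact: ltW.
  - by rewrite !mulr_ge0 ?exprn_ge0// ltW.
  - move=> j _ jk; have w0 : 0 < t ^+ (k ^ 2 + k ^ 2)%N by rewrite exprn_gt0.
    rewrite /tau !exprVn -!exprM ler_pdivrMr ?exprn_gt0//.
    rewrite mulrA mulrAC ler_pdivlMr ?exprn_gt0// -exprS -!exprD.
    rewrite ler_wiXn2l ?(ltW t0) ?(ltW t1)//.
    have := nat_Cauchy k j; rewrite eq_sym (negPf jk) => /ltn_leqif; lia.
  - by rewrite -spt.
  rewrite -/pt -!mulrA ltr_pM2r ?mulr_gt0 ?pt_gt0 ?exprn_gt0 ?mulr_gt0//; lra.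
have [|rs] := @strictly_lopsided_split _ pt eps pt_gt0 pt_lop.
  by rewrite -size_poly_gt0 spt.
have -> : diag_op (fun i => (-1) ^+ eps i) pt = diag_op (fun i => t ^+ (i ^ 2)) q.
  by apply/polyP => i; rewrite !coef_diag_op mulrCA.
set qt := diag_op _ q => qtE; have := split_norm_ge z qtE.
have sq : size q = size p by rewrite size_diag_op.
have sqt : size qt = size p by rewrite size_diag_op sq.
rewrite lead_coefE sqt -/n !coef_diag_op normrM normrMsign.
rewrite (gtr0_norm (p_gt0 _ np)) ger0_norm ?exprn_ge0 ?(ltW t0)// => h.
have -> : p`_n * `|complex.Im z| ^+ n * t ^+ (n ^ 2) =
  t ^+ (n ^ 2) * p`_n * `|complex.Im z| ^+ n by ring.
rewrite -lecR; apply: le_trans h _; rewrite rmorphM/= -ME.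
(* Subtracting [q(z) = 0] allows a comparison of [qt] and [q] term by term. *)
rewrite -[X in `|X|]subr0 -(rootP qz) !(@horner_coef_wide _ (size p)); last 2 first.
- by rewrite size_map_poly sq.
- by rewrite size_map_poly sqt.
rewrite -sumrB /M mulr_sumr; apply: le_trans (ler_norm_sum _ _ _) _.
apply: ler_sum => i _; rewrite !coef_map/= [qt`__]coef_diag_op.
rewrite rmorphM/= -mulrA -{2}[_ * z ^+ i]mul1r -mulrBl normrM mulrCA mulrC.
apply: ler_wpM2l => //.
rewrite -(rmorph1 (real_complex R)) -rmorphB/= -(rmorph_nat (real_complex R)) -rmorphM/=.
rewrite normc_def/= expr0n addr0 sqrtr_sqr distrC ger0_norm; last first.
  by rewrite subr_ge0 exprn_ile1 ?ltW.
by rewrite lecR mulrC bernoulli_expr// !ltW.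
Qed.

(** * Log-concave diagonal operators preserve sign-independent real-rootedness *)

Lemma SInn_diag_op0 (R : realType) (gamma : nat -> R) (p : {poly R}) :
  SInn R p -> 0 < p`_0 ->
  (forall i, (i < size p)%N -> 0 < gamma i) ->
  (forall j, (1 <= j)%N -> (j.+1 < size p)%N ->
    gamma j.-1 * gamma j.+1 <= gamma j ^+ 2) ->
  SInn R (diag_op gamma p).
Proof.
move=> pS p0 g_gt0 g_lc; have p_gt0 i := @SInn_coef_gt0 R p i pS p0.
have p_ge0 : forall i, 0 <= p`_i by case: pS.
have sgp : size (diag_op gamma p) = size p.
  by rewrite size_diag_op// => i /g_gt0/gt_eqF->.
have gp_gt0 i : (i < size p)%N -> 0 < (diag_op gamma p)`_i.
  by move=> ip; rewrite coef_diag_op mulr_gt0 ?g_gt0 ?p_gt0.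
apply/SInnE; split=> [eps|i]; last first.
  by case: (ltnP i (size p)) => [/gp_gt0/ltW//|ip]; rewrite nth_default ?sgp.
apply: lopsided_flip_RR; rewrite ?sgp//.
  rewrite -size_poly_gt0 sgp size_poly_gt0; apply/eqP => p00.
  by rewrite p00 coef0 ltxx in p0.
move=> k kp; have [x x0 px] := SInn_lopsided pS p0 kp.
have [tau tau0 le_k] := log_concave_argmax g_gt0 g_lc kp.
exists (tau * x); first by rewrite mulr_gt0.
rewrite -[2]/(1 + 1 : R).
apply: horner_diag_op_le => //; rewrite ?mul1r ?(ltW x0)//.
  by rewrite mulr_ge0 ?exprn_ge0 ?ltW ?g_gt0.
by move=> j jp _; rewrite le_k.
Qed.

Lemma SInn_XnM (R : realType) (m : nat) (p : {poly R}) :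
  SInn R ('X^m * p) <-> SInn R p.
Proof.
split=> /SInnE[pR p_ge0]; apply/SInnE; split=> [eps|i].
(* Only indices of the form [i + m] are read after the shift, so the truncated subtraction is
   harmless. *)
- have := pR (fun i => eps (i - m)%N); rewrite diag_op_XnM => /RR_mulr.
  by congr (RR R _); apply/polyP => i; rewrite !coef_diag_op addnK.
- by have := p_ge0 (i + m)%N; rewrite coefXnM ltnNge leq_addl addnK.
- by rewrite diag_op_XnM; apply/RR_XnM/(pR (fun i => eps (i + m)%N)).
- by rewrite coefXnM; case: ifP.
Qed.

(** Splitting off the largest power of ['X] reduces to a positive constant term; a shift of [gamma]
    stays positive and log-concave on the range needed. *)
Lemma SInn_diag_op (R : realType) (gamma : nat -> R) (p : {poly R}) :
  (forall i, (i < size p)%N -> 0 < gamma i) ->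
  (forall j, (1 <= j)%N -> (j.+1 < size p)%N ->
    gamma j.-1 * gamma j.+1 <= gamma j ^+ 2) ->
  SInn R p -> SInn R (diag_op gamma p).
Proof.
move=> g_gt0 g_lc pS.
have p_neq0 : p != 0.
  apply/eqP => p0; case: pS => -[pR _] _.
  have := pR 'i%C; rewrite p0 rmorph0 root0 => /(_ isT)/eqP.
  by rewrite oner_eq0.
have [m [q q0 pE]] := multiplicity_XsubC p 0.
rewrite p_neq0/= polyC0 subr0 mulrC in q0 pE.
have q_neq0 : q != 0 by apply: contraNneq q0 => ->; rewrite root0.
have sp : size p = (m + size q)%N by rewrite pE mulrC size_mulXn// addnC.
rewrite pE in pS *; move/SInn_XnM: pS => qS; rewrite diag_op_XnM; apply/SInn_XnM.
apply: SInn_diag_op0 => //.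
- by rewrite lt_def -horner_coef0 -rootE q0; case: qS => _ /(_ 0%N); rewrite horner_coef0.
- by move=> i iq; rewrite g_gt0// sp addnC ltn_add2l.
case=> [//|j] _ jq; have := g_lc (j.+1 + m)%N; rewrite sp !addSn; apply=> //.
by rewrite -2!addSn addnC ltn_add2l.
Qed.

(** * The test polynomials ['X^n * (1 + 'X) ^+ 2] *)

Lemma square_1DX (R : comNzRingType) :
  (1 + 'X) ^+ 2 = 'X^0 + 2 *: 'X^1 + 'X^2 :> {poly R}.
Proof. by rewrite expr0 expr1 -mul_polyC; ring. Qed.

(* Were the discriminant of the quadratic factor negative, its conjugate roots
   could be written down explicitly. *)
Lemma RR_diag_XnM_square (R : realType) (gamma : nat -> R) (n : nat) :
  0 < gamma n.+2 -> RR R (diag_op gamma ('X^n * (1 + 'X) ^+ 2)) ->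
  gamma n * gamma n.+2 <= gamma n.+1 ^+ 2.
Proof.
move=> c0; rewrite diag_op_XnM => /RR_mulr qR; rewrite leNgt; apply/negP => disc.
set a := gamma n in disc; set b := gamma n.+1 in disc; set c := gamma n.+2 in c0 disc.
pose d := Num.sqrt (a * c - b ^+ 2).
have dE : d * d = a * c - b ^+ 2 by rewrite -expr2 sqr_sqrtr// subr_ge0 ltW.
have d0 : 0 < d by rewrite sqrtr_gt0 subr_gt0.
(* This is the root [(-b + d i) / c] of [a + 2 b X + c X^2], which is not real because [d > 0]. *)
have := qR (Complex (- b / c) (d / c)) => /=.
have -> : diag_op (fun i => gamma (i + n)%N) ((1 + 'X) ^+ 2) =
    a%:P + (2 * b) *: 'X + c *: 'X^2.
  rewrite square_1DX !linearD linearZ/= !diag_opXn expr0 alg_polyC scalerA.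
  by rewrite mulrC.
rewrite rootE !rmorphD/= !map_polyZ/= map_polyC map_polyX map_polyXn !hornerE.
move=> qz; have c_neq0 : c != 0 by rewrite gt_eqF.
have /eqP : d / c = 0; last by rewrite mulf_eq0 invr_eq0 !gt_eqF.
apply: qz; rewrite eq_complex/=; apply/andP; split; apply/eqP; last by field.
transitivity ((a * c - b ^+ 2 - d * d) / c); first by field.
by rewrite dE subrr mul0r.
Qed.

Lemma size_square_1DX (R : idomainType) : size ((1 + 'X) ^+ 2 : {poly R}) = 3.
Proof. by rewrite addrC -[1]opprK -polyC1 -polyCN size_exp_XsubC. Qed.

Lemma SInn_XnM_square (R : realType) (n : nat) : SInn R ('X^n * (1 + 'X) ^+ 2).
Proof.
apply/SInn_XnM; set p := (1 + 'X) ^+ 2.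
have sp : size p = 3 by exact: size_square_1DX.
have pE i : p`_i = (i == 0)%:R + 2 * (i == 1)%:R + (i == 2)%:R.
  by rewrite /p square_1DX !coefD coefZ !coefXn.
apply/SInnE; split=> [eps|i]; last by rewrite pE !addr_ge0 ?mulr_ge0.
apply: lopsided_flip_RR; rewrite ?sp.
- by rewrite -size_poly_gt0 sp.
- by case=> [|[|[|]]]// _; rewrite pE/=; lra.
(* The terms 1, [2 x] and [x^2] dominate at 1/4, 1 and 4; for the middle one there is equality, so
   weak domination is essential. *)
case=> [|[|[|]]]// _; rewrite pE /p.
- by exists 4^-1; rewrite ?invr_gt0// !hornerE/=; lra.
- by exists 1; rewrite // !hornerE/=; lra.
- by exists 4; rewrite // !hornerE/=; lra.
Qed.

Theorem theorem1 (R : realType) :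
  (forall gamma : nat -> R, (forall j : nat, 0 < gamma j) ->
     [/\ (diag_op gamma @` SInn R `<=` RR R <->
          forall j : nat, (1 <= j)%N ->
            gamma j.-1 * gamma j.+1 <= gamma j ^+ 2),
         ((forall j : nat, (1 <= j)%N ->
            gamma j.-1 * gamma j.+1 <= gamma j ^+ 2) <->
          forall n : nat, RR R (diag_op gamma ('X^n * (1 + 'X) ^+ 2)))
       & ((forall j : nat, (1 <= j)%N ->
            gamma j.-1 * gamma j.+1 <= gamma j ^+ 2) ->
          diag_op gamma @` SInn R `<=` SInn R)])
  /\
  (forall (k : nat) (gamma : k.+1.-tuple R), (1 <= k)%N ->
     (forall j : nat, (j <= k)%N -> 0 < gamma`_j) ->
     [/\ (diag_op (nth 0 gamma) @` SInn_deg R k `<=` RR R <->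
          forall j : nat, (1 <= j <= k - 1)%N ->
            gamma`_j.-1 * gamma`_j.+1 <= gamma`_j ^+ 2),
         ((forall j : nat, (1 <= j <= k - 1)%N ->
            gamma`_j.-1 * gamma`_j.+1 <= gamma`_j ^+ 2) <->
          forall n : nat, (n + 2 <= k)%N ->
            RR R (diag_op (nth 0 gamma) ('X^n * (1 + 'X) ^+ 2)))
       & ((forall j : nat, (1 <= j <= k - 1)%N ->
            gamma`_j.-1 * gamma`_j.+1 <= gamma`_j ^+ 2) ->
          diag_op (nth 0 gamma) @` SInn_deg R k `<=` SInn_deg R k)]).
Proof.
have square_size n : size ('X^n * (1 + 'X) ^+ 2 : {poly R}) = n.+3.
  by rewrite mulrC size_mulXn ?size_square_1DX ?addn3// -size_poly_eq0 size_square_1DX.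
split=> [gamma g_gt0|k gamma k_gt0 g_gt0].
(* Two implications carry everything: test polynomials to log-concavity, and log-concavity to
   preservation. The rest follows since the test polynomials lie in [SInn] and [SInn] lies in
   [RR]. *)
- have sq_lc : (forall n, RR R (diag_op gamma ('X^n * (1 + 'X) ^+ 2))) ->
      forall j, (1 <= j)%N -> gamma j.-1 * gamma j.+1 <= gamma j ^+ 2.
    by move=> gR [//|n] _; apply: RR_diag_XnM_square.
  have lc_SI : (forall j, (1 <= j)%N -> gamma j.-1 * gamma j.+1 <= gamma j ^+ 2) ->
      diag_op gamma @` SInn R `<=` SInn R.
    by move=> lc _ [p pS <-]; apply: SInn_diag_op => // j j0 _; apply: lc.
  split=> //; split.
  + by move=> gR; apply: sq_lc => n; apply: gR; exists ('X^n * (1 + 'X) ^+ 2) => //;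
      apply: SInn_XnM_square.
  + by move=> /lc_SI sub p /sub[[]].
  + move=> /lc_SI sub n.
    by have [[]] : SInn R (diag_op gamma ('X^n * (1 + 'X) ^+ 2))
      by apply: sub; exists ('X^n * (1 + 'X) ^+ 2) => //; apply: SInn_XnM_square.
  + exact: sq_lc.
(* The test polynomial has degree [n + 2], so the bound on [n] is exactly membership in the space of
   degree at most [k]. *)
have sq_in n : (n + 2 <= k)%N -> SInn_deg R k ('X^n * (1 + 'X) ^+ 2).
  by move=> nk; split; [apply: SInn_XnM_square | rewrite square_size; lia].
have sq_lc : (forall n, (n + 2 <= k)%N ->
      RR R (diag_op (nth 0 gamma) ('X^n * (1 + 'X) ^+ 2))) ->
    forall j, (1 <= j <= k - 1)%N -> gamma`_j.-1 * gamma`_j.+1 <= gamma`_j ^+ 2.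
  move=> gR [//|n] /andP[_ nk]; apply: RR_diag_XnM_square; first by apply: g_gt0; lia.
  by apply: gR; lia.
have lc_SI : (forall j, (1 <= j <= k - 1)%N ->
      gamma`_j.-1 * gamma`_j.+1 <= gamma`_j ^+ 2) ->
    diag_op (nth 0 gamma) @` SInn_deg R k `<=` SInn_deg R k.
  move=> lc _ [p [pS pk] <-]; split; last exact: leq_trans (size_poly _ _) pk.
  apply: SInn_diag_op => // [i ip|j j0 jp].
    by apply: g_gt0; rewrite -ltnS (leq_trans ip).
  by apply: lc; lia.
split=> //; split.
- by move=> gR; apply: sq_lc => n nk; apply: gR; exists ('X^n * (1 + 'X) ^+ 2) => //;
    apply: sq_in.
- by move=> /lc_SI sub p /sub[[[]]].
- move=> /lc_SI sub n nk.
  by have [[[]]] : SInn_deg R k (diag_op (nth 0 gamma) ('X^n * (1 + 'X) ^+ 2))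
    by apply: sub; exists ('X^n * (1 + 'X) ^+ 2) => //; apply: sq_in.
- exact: sq_lc.
Qed.
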